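(* Suppose $\Pi_{PIR}=(\mathsf{Query},\mathsf{Answer},\mathsf{Decode})$ is a computationally private PIR scheme. Then the single-round PILLAR-Bin protocol (described in the context, with its PIR queries made with $\Pi_{PIR}$) is secure against a semi-honest server.
   Context: **PIR.** A single-server PIR (private information retrieval) scheme $\Pi_{PIR}=(\mathsf{Query},\mathsf{Answer},\mathsf{Decode})$ over a database $DB$ of $n$ records is *computationally private* if, with $\lambda$ the security parameter: (1) correctness: for any index $i\in[n]$, $\Pr[\mathsf{Decode}(\mathsf{Answer}(DB,\mathsf{Query}(i)))=DB[i]]\ge 1-\mathsf{negl}(\lambda)$; (2) privacy: for all indices $i,j\in[n]$ and all PPT distinguishers $\mathcal D$, $|\Pr[\mathcal D(\mathsf{Query}(i))=1]-\Pr[\mathcal D(\mathsf{Query}(j))=1]|\le\mathsf{negl}(\lambda)$. PIR is used with a preprocessing phase, run between server and client before any query, in which the client initializes a private state. A batched PIR query packs several indices into a single query. **Security.** A semi-honest server follows the protocol but tries to learn about the client's query. Security is defined via the standard simulation paradigm: there is a PPT simulator that, given only the public parameters (including $\lambda$ and the fixed batch size $\beta$), produces an output computationally indistinguishable from the server's view in a real execution, for every client query $Q$. The server performs the construction of the database itself and knows it in full; during retrieval its view consists solely of the $\beta$ PIR queries $\mathsf{Query}(r_1),\dots,\mathsf{Query}(r_\beta)$ for the $\beta$ row indices in the client's batch. **Public parameters.** A corpus $\mathcal C=\{D_1,\dots,D_N\}$ of documents, each with an index $\mathsf{id}(D)$; an analyzer $\mathsf{Analyze}$ mapping text to a finite sequence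 of terms; the vocabulary $\mathcal V=\bigcup_{D\in\mathcal C}\mathsf{Analyze}(D)$; an embedding function $\mathsf{Emb}$ mapping text to $\mathbb R^d$; the parameters $(k_1,b)$ of the BM25 lexical scoring function; a row count $R$; a row depth $t$; a hash function $H:\mathcal V\to\{0,\dots,R-1\}$; a batch bound $\beta$; an output size $k$; a reserved dummy index $\bot$. **Single-round PILLAR-Bin protocol.** The client's input is a query $Q$ with $\mathsf{Analyze}(Q)=(w_1,\dots,w_{|Q|})$. *Preprocessing (server).* The server initializes an empty database $DB$ of $R$ rows. For each $w\in\mathcal V$ it scores every $D\in\mathcal C$ containing $w$ under BM25 with $w$ as a single-term query, and lets $\mathcal L_w$ be the list of the $t$ highest-scoring documents in descending order, padded with $\langle\bot,\mathbf 0\rangle$ if fewer than $t$ documents contain $w$. For each row $z$, let $w^{(1)},\dots,w^{(m_z)}$ be the terms $w\in\mathcal V$ with $H(w)=z$, in an arbitrary fixed order. The server fills row $z$ round-robin: the $j$-th document of $\mathcal L_{w^{(i)}}$ goes to position $(j-1)m_z+i$. It then discards duplicates and truncates each row to its first $t$ documents; a row with $m_z=0$ is left empty. It replaces each stored document $D$ by the pair $\langle\mathsf{id}(D),\mathsf{Emb}(D)\rangle$. Finally the server runs the PIR preprocessing phase over this database with the client, who stores the resulting private state. *Retrieval.* The client computes $\mathsf{Analyze}(Q)$ and the row indices $r_i=H(w_i)$ for $i\le|Q|$, removing repeated indices. It fixes the batch to exactly $\beta$ indices: if $|Q|>\beta$ it retains the first $\beta$; if $|Q|<\beta$ it pads with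 random indices from $\{0,\dots,R-1\}$. It sends a single batched PIR query for these $\beta$ indices and recovers the corresponding $\beta$ rows from the server's response and its private state. Locally, it discards entries with index $\bot$ and duplicate indices, obtaining a candidate pool of at most $\beta t$ embeddings, computes $\mathsf{Emb}(Q)$, ranks the candidates by cosine similarity to $\mathsf{Emb}(Q)$, and outputs the $k$ document indices of highest similarity. No other message passes from the client to the server during retrieval. *)

(* Defs.v *)
From mathcomp Require Import all_boot all_order all_algebra.
From mathcomp Require Import reals exp.

Set Implicit Arguments.
Unset Strict Implicit.
Unset Printing Implicit Defensive.

Import Order.TTheory GRing.Theory Num.Theory.

Local Open Scope ring_scope.

Declare Scope rand_scope.
Delimit Scope rand_scope with rand.

(** * Finite randomized computations *)

(* A computation making finitely many uniform draws from finite sets.  The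
   element of [T] carried by [Draw] only witnesses that [T] is inhabited, so
   that every computation has total mass 1. *)
Inductive rand (A : Type) : Type :=
| Ret of A
| Draw (T : finType) of T & (T -> rand A).

Fixpoint bind (A B : Type) (m : rand A) (f : A -> rand B) : rand B :=
  match m with
  | Ret a => f a
  | Draw _ x0 k => Draw x0 (fun x => bind (k x) f)
  end.

Notation "'let*' x ':=' m 'in' k" := (bind m (fun x => k))
  (at level 200, x name, m at level 100, k at level 200) : rand_scope.
Open Scope rand_scope.

Fixpoint Pr (A : Type) (m : rand A) (E : pred A) : rat :=
  match m with
  | Ret a => (E a)%:R
  | Draw T _ k => (\sum_(x : T) Pr (k x) E) / #|T|%:R
  end.

(* Independent runs of [f], from left to right. *)
Fixpoint traverse (A B : Type) (f : A -> rand B) (n : nat) :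
    n.-tuple A -> rand (n.-tuple B) :=
  match n return n.-tuple A -> rand (n.-tuple B) with
  | 0 => fun _ => Ret [tuple]
  | _.+1 => fun t =>
      let* y := f (thead t) in
      let* ys := traverse f (behead_tuple t) in
      Ret (cons_tuple y ys)
  end.

Definition negligible (mu : nat -> rat) : Prop :=
  forall c : nat, exists N : nat, forall lam : nat,
    (N <= lam)%N -> `|mu lam| < lam%:R ^- c.

(** * Probabilistic polynomial time *)

Definition bits := seq bool.

(* Probabilistic structured programs over registers holding bit strings.
   A register is a stack accessed at its head; two of them simulate a tape, so
   that multi-tape probabilistic Turing machines are simulated with constant
   overhead.  Conversely, one step lengthens the longest register by at most
   one bit, hence unit cost for each command (including [Copy]) is polynomially
   related to Turing machine time. *)
Inductive prog : Type :=
| Push of bool & nat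
| Pop of nat
| Copy of nat & nat
| Flip of nat
| Seq of prog & prog
| If of nat & prog & prog
| While of nat & prog.

Definition store := nat -> bits.

Definition upd (s : store) (x : nat) (v : bits) : store :=
  fun y => if y == x then v else s y.

(* [run T k s] executes the list [k] of pending commands from the store [s]
   during at most [T] steps; [None] means that time has run out.
   [Copy x y] assigns to [x] the contents of [y], [Flip x] pushes a uniform bit
   on [x], [If x] tests whether the head of [x] is [true], and [While x] loops
   as long as [x] is nonempty. *)
Fixpoint run (T : nat) (k : seq prog) (s : store) : rand (option store) :=
  match k, T with
  | [::], _ => Ret (Some s)
  | _ :: _, 0 => Ret None
  | c :: k, T.+1 =>
      match c with
      | Push b x => run T k (upd s x (b :: s x))
      | Pop x => run T k (upd s x (behead (s x)))
      | Copy x y => run T k (upd s x (s y))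
      | Flip x => Draw true (fun b => run T k (upd s x (b :: s x)))
      | Seq c1 c2 => run T (c1 :: c2 :: k) s
      | If x c1 c2 => run T ((if head false (s x) then c1 else c2) :: k) s
      | While x c1 =>
          run T (if nilp (s x) then k else c1 :: While x c1 :: k) s
      end
  end.

(* [f] is computed in probabilistic polynomial time: the program receives
   1^lam in register 0 and the strings [enc x] in the following ones (all others
   being empty), always halts in time polynomial in the total input length, and
   [out], read off the final store, is distributed as [f lam x]. *)
Definition ppt (X Y : Type) (enc : X -> seq bits) (out : store -> Y)
    (f : nat -> X -> rand Y) : Prop :=
  exists (c : prog) (e : nat), forall (lam : nat) (x : X),
    let input := nseq lam true :: enc x in
    let len := sumn (map size input) in
    let final := run (len ^ e + e)%N [:: c] (nth [::] input) in
    Pr final isSome = 1 /\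
    forall E : pred Y, Pr final (oapp (E \o out) false) = Pr (f lam x) E.

Definition out_bit (s : store) : bool := head false (s 0%N).

(* Distinguishers for ensembles of [m] strings. *)
Definition ppt_distinguisher (m : nat) (D : nat -> m.-tuple bits -> rand bool) :=
  ppt (@tval m bits) out_bit D.

(** * Private information retrieval *)

(* - [pir_prep] is the joint preprocessing phase; it returns the private state
     of the client.
   - [pir_query lam i] returns the message sent to the server, together with a
     secret kept by the client for decoding its answer; without such a secret,
     anyone holding the answer could decode it.
   Its coins are independent of the preprocessing and of other queries. *)
Record pir (n : nat) (Rec : eqType) := Pir {
  pir_state : Type;
  pir_reply : Type;
  pir_prep : nat -> ('I_n -> Rec) -> rand pir_state;
  pir_query : nat -> 'I_n -> rand (bits * bits);
  pir_answer : nat -> ('I_n -> Rec) -> bits -> rand pir_reply;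
  pir_decode : nat -> pir_state -> bits -> pir_reply -> rand Rec
}.

Section PIR.
Variables (n : nat) (Rec : eqType) (P : pir n Rec).

(* [n] does not depend on [lam], so the unary encoding of the index is
   harmless. *)
Definition query_ppt : Prop :=
  ppt (fun i : 'I_n => [:: nseq i true]) (fun s => (s 0%N, s 1%N)) (pir_query P).

Definition retrieve (lam : nat) (DB : 'I_n -> Rec) (i : 'I_n) : rand Rec :=
  let* st := pir_prep P lam DB in
  let* q := pir_query P lam i in
  let* a := pir_answer P lam DB q.1 in
  pir_decode lam st q.2 a.

Definition pir_correct : Prop :=
  forall DB : 'I_n -> Rec, exists2 mu, negligible mu &
    forall (lam : nat) (i : 'I_n),
      1 - mu lam <= Pr (retrieve lam DB i) (pred1 (DB i)).

Definition query_message (lam : nat) (i : 'I_n) : rand bits :=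
  let* q := pir_query P lam i in Ret q.1.

Definition pir_private : Prop :=
  forall D : nat -> 1.-tuple bits -> rand bool, ppt_distinguisher D ->
  exists2 mu, negligible mu &
    forall (lam : nat) (i j : 'I_n),
      `|Pr (let* q := query_message lam i in D lam [tuple q]) id
        - Pr (let* q := query_message lam j in D lam [tuple q]) id| <= mu lam.

Definition computationally_private : Prop :=
  [/\ query_ppt, pir_correct & pir_private].

End PIR.

(** * The single-round PILLAR-Bin protocol *)

(* Unlike [undup], keeps the first of the elements with equal keys. *)
Definition dedup_on (A : Type) (K : eqType) (key : A -> K) (s : seq A) : seq A :=
  foldl (fun acc x => if key x \in map key acc then acc else rcons acc x)
    [::] s.

(* The dummy index is [None : option docid].  [hash] is defined on all terms,
   since those of a query need not occur in the corpus; [row_terms z] lists the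
   terms of row [z] in an arbitrary order. *)
Record params (R : realType) := Params {
  text : Type;
  term : eqType;
  doc : eqType;
  docid : eqType;
  corpus : seq doc;
  corpus_uniq : uniq corpus;
  content : doc -> text;
  id_of : doc -> docid;
  analyze : text -> seq term;
  dim : nat;
  emb : text -> 'rV[R]_dim;
  bm25_k1 : R;
  bm25_b : R;
  rows : nat;
  rows_gt0 : (0 < rows)%N;
  depth : nat;
  hash : term -> 'I_rows;
  vocabulary := undup (flatten [seq analyze (content D) | D <- corpus]);
  row_terms : 'I_rows -> seq term;
  row_termsP : forall z : 'I_rows,
    perm_eq (row_terms z) [seq w <- vocabulary | hash w == z];
  batch_size : nat;
  output_size : nat
}.

Section Protocol.
Variables (R : realType) (pp : params R).
Implicit Types (w : term pp) (D : doc pp) (Q : text pp) (z : 'I_(rows pp)).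

Definition doc_terms D : seq (term pp) := analyze (content D).

Definition avg_doc_len : R :=
  (\sum_(D <- corpus pp) (size (doc_terms D))%:R) / (size (corpus pp))%:R.

Definition doc_freq w : nat := count (fun D => w \in doc_terms D) (corpus pp).

(* The everywhere positive variant of the inverse document frequency; for a
   fixed term it does not affect the ranking of documents. *)
Definition idf w : R :=
  ln (1 + ((size (corpus pp))%:R - (doc_freq w)%:R + 2^-1)
          / ((doc_freq w)%:R + 2^-1)).

(* BM25 score of a document for a single-term query. *)
Definition bm25 w D : R :=
  let tf : R := (count_mem w (doc_terms D))%:R in
  let len : R := (size (doc_terms D))%:R in
  idf w * (tf * (bm25_k1 pp + 1))
    / (tf + bm25_k1 pp * (1 - bm25_b pp + bm25_b pp * (len / avg_doc_len))).

(* The list L_w; [None] stands for the padding entry.  Ties are broken by the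
   order of the corpus ([sort] is stable). *)
Definition posting w : seq (option (doc pp)) :=
  let hits := [seq D <- corpus pp | w \in doc_terms D] in
  let best := take (depth pp) (sort (fun D E => bm25 w E <= bm25 w D) hits) in
  map some best ++ nseq (depth pp - size best) None.

Definition entry : eqType := (option (docid pp) * 'rV[R]_(dim pp))%type.
Definition row_record : eqType := seq entry.

Definition entry_of (o : option (doc pp)) : entry :=
  if o is Some D then (Some (id_of D), emb (content D)) else (None, 0).

(* The comprehension is row-major: the rank [j] varies in the outer loop and
   the term [w] in the inner one, i.e. rows are filled round-robin. *)
Definition database z : row_record :=
  let filled :=
    [seq nth None (posting w) j | j <- iota 0 (depth pp), w <- row_terms z] in
  map entry_of (take (depth pp) (dedup_on id filled)).

Definition query_rows Q : seq 'I_(rows pp) :=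
  dedup_on id (map (@hash R pp) (analyze Q)).

(* Slot [i] holds the [i]-th distinct row of the query if there is one, and
   otherwise an independent uniform row. *)
Definition batch Q : rand ((batch_size pp).-tuple 'I_(rows pp)) :=
  Draw [tuple Ordinal (rows_gt0 pp) | _ < batch_size pp]
    (fun pad => Ret [tuple nth (tnth pad i) (query_rows Q) i
                    | i < batch_size pp]).

Definition dot (u v : 'rV[R]_(dim pp)) : R := \sum_j u 0 j * v 0 j.

Definition cosine (u v : 'rV[R]_(dim pp)) : R :=
  dot u v / (Num.sqrt (dot u u) * Num.sqrt (dot v v)).

Definition rank_candidates Q (rs : seq row_record) : seq (docid pp) :=
  let genuine :=
    pmap (fun e : entry => omap (fun i => (i, e.2)) e.1) (flatten rs) in
  let pool := dedup_on fst genuine in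
  let sim (c : docid pp * 'rV[R]_(dim pp)) := cosine (emb Q) c.2 in
  map fst (take (output_size pp) (sort (fun c d => sim d <= sim c) pool)).

Variable P : pir (rows pp) row_record.

Definition server_view_type := (batch_size pp).-tuple bits.

(* A joint execution, returning what the server receives during retrieval (its
   only incoming message, the batched query) and the output of the client. *)
Definition execution (lam : nat) Q : rand (server_view_type * seq (docid pp)) :=
  let* st := pir_prep P lam database in
  let* r := batch Q in
  let* qs := traverse (pir_query P lam) r in
  let view := map_tuple fst qs in
  let* answers := traverse (pir_answer P lam database) view in
  let* rs := traverse (fun qa => pir_decode lam st qa.1.2 qa.2)
               (zip_tuple qs answers) in
  Ret (view, rank_candidates Q rs).

Definition server_view (lam : nat) Q : rand server_view_type :=
  let* e := execution lam Q in Ret e.1.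

Definition sim_output (s : store) : server_view_type :=
  [tuple s (nat_of_ord i) | i < batch_size pp].

(* The simulator may depend on the public parameters; its only input is
   1^lam. *)
Definition secure_semi_honest_server : Prop :=
  exists2 Sim : nat -> rand server_view_type,
    ppt (fun _ : unit => [::]) sim_output (fun lam _ => Sim lam) &
    forall D : nat -> (batch_size pp).-tuple bits -> rand bool,
      ppt_distinguisher D ->
      exists2 mu, negligible mu &
        forall (lam : nat) Q,
          `|Pr (let* v := server_view lam Q in D lam v) id
            - Pr (let* v := Sim lam in D lam v) id| <= mu lam.

End Protocol.

(* Main.v *)
Require Import Defs.
From mathcomp Require Import all_boot all_order all_algebra.
From mathcomp Require Import reals exp.
From mathcomp Require Import zify.
From Stdlib Require Import FunctionalExtensionality.

(** The simulator sends the queries of a fixed tuple of rows. For each of the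
finitely many batches [r], a hybrid argument replaces the rows of [r] one at a
time by those of the fixed tuple: the remaining queries are sampled by the
distinguisher, which has the finitely many row indices hardcoded, so each step
is an instance of the privacy of single queries. The bound is uniform in the
query [Q] because it is summed over all batches, whose number does not depend on
the security parameter. What the client computes after sending its message has
total mass 1 and drops out of the view.

The substance is that these hybrid distinguishers are again polynomial time:
two programs are run one after the other in disjoint register banks, obtained by
injective renamings, and strings are copied between the banks. *)

Set Implicit Arguments.
Unset Strict Implicit.
Unset Printing Implicit Defensive.

Import Order.TTheory GRing.Theory Num.Theory.

Local Open Scope ring_scope.

(** * Expectations and equality of distributions *)

Section RandTheory.
Variables A B C : Type.
Implicit Types (m : rand A) (E : pred A).

Lemma bindA m (f : A -> rand B) (g : B -> rand C) :
  bind (bind m f) g = bind m (fun a => bind (f a) g).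
Proof.
elim: m => [//|T x0 k IH] /=; congr Draw; apply: functional_extensionality => x.
exact: IH.
Qed.

(** A condition on all leaves of the tree. Each leaf has positive weight, so for events this is
    probability 1 ([Pr_eq1]), but it also supports rewriting of the tree itself. *)
Fixpoint always m (P : A -> Prop) : Prop :=
  match m with
  | Ret a => P a
  | Draw T _ k => forall x : T, always (k x) P
  end.

Lemma always_impl m (P Q : A -> Prop) :
  (forall a, P a -> Q a) -> always m P -> always m Q.
Proof. by move=> PQ; elim: m => [a|T x0 k IH] /= H; [exact: PQ | move=> x; exact: IH]. Qed.

Lemma eq_bind_always m (P : A -> Prop) (f g : A -> rand B) :
  always m P -> (forall a, P a -> f a = g a) -> bind m f = bind m g.
Proof.
move=> + fg; elim: m => [a|T x0 k IH] /= H; first exact: fg.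
by congr Draw; apply: functional_extensionality => x; apply: IH.
Qed.

Fixpoint Ex m (phi : A -> rat) : rat :=
  match m with
  | Ret a => phi a
  | Draw T _ k => (\sum_(x : T) Ex (k x) phi) / #|T|%:R
  end.

Lemma Pr_Ex m E : Pr m E = Ex m (fun a => (E a)%:R).
Proof. by elim: m => [//|T x0 k IH] /=; congr (_ / _); apply: eq_bigr => x _; apply: IH. Qed.

Lemma Pr_bind m (f : A -> rand B) (E : pred B) :
  Pr (bind m f) E = Ex m (fun a => Pr (f a) E).
Proof. by elim: m => [//|T x0 k IH] /=; congr (_ / _); apply: eq_bigr => x _; apply: IH. Qed.

Lemma eq_Ex_always m (P : A -> Prop) (phi psi : A -> rat) :
  always m P -> (forall a, P a -> phi a = psi a) -> Ex m phi = Ex m psi.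
Proof.
move=> + e; elim: m => [a|T x0 k IH] /= H; first exact: e.
by congr (_ / _); apply: eq_bigr => x _; apply: IH.
Qed.

Lemma always_true m : always m (fun=> True).
Proof. by elim: m => [//|T x0 k IH] /=. Qed.

Lemma eq_Ex m (phi psi : A -> rat) : phi =1 psi -> Ex m phi = Ex m psi.
Proof. by move=> e; apply: (eq_Ex_always (always_true m)) => a _; apply: e. Qed.

Lemma Ex_sum m (I : Type) (r : seq I) (F : I -> A -> rat) :
  Ex m (fun a => \sum_(i <- r) F i a) = \sum_(i <- r) Ex m (F i).
Proof.
elim: m => [//|T x0 k IH] /=; rewrite -mulr_suml exchange_big /=.
by congr (_ / _); apply: eq_bigr => x _; apply: IH.
Qed.

Lemma Ex_mulr m (phi : A -> rat) c : Ex m (fun a => phi a * c) = Ex m phi * c.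
Proof.
elim: m => [//|T x0 k IH] /=; rewrite [RHS]mulrAC; congr (_ / _); rewrite mulr_suml.
by apply: eq_bigr => x _; apply: IH.
Qed.

Lemma card_gt0_of (T : finType) (x0 : T) : 0 < #|T|%:R :> rat.
Proof. by rewrite ltr0n; apply/card_gt0P; exists x0. Qed.

Lemma Ex_cst m c : Ex m (fun=> c) = c.
Proof.
elim: m => [//|T x0 k IH] /=; rewrite (eq_bigr (fun=> c)) => [|x _]; last exact: IH.
by rewrite sumr_const -[c *+ _]mulr_natr mulfK // gt_eqF // (card_gt0_of x0).
Qed.

Lemma Ex_ge0 m phi : (forall a, 0 <= phi a) -> 0 <= Ex m phi.
Proof.
move=> p0; elim: m => [//|T x0 k IH] /=.
by rewrite divr_ge0 ?ler0n // sumr_ge0.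
Qed.

Lemma Ex_sub m phi psi : Ex m (fun a => phi a - psi a) = Ex m phi - Ex m psi.
Proof.
elim: m => [//|T x0 k IH] /=; rewrite -mulrBl -sumrB.
by congr (_ / _); apply: eq_bigr => x _; apply: IH.
Qed.

Lemma Ex_eq0 m phi : (forall a, 0 <= phi a) -> Ex m phi = 0 ->
  always m (fun a => phi a = 0).
Proof.
move=> p0; elim: m => [//|T x0 k IH] /= /eqP.
(* A vanishing average of nonnegative terms has a vanishing sum, hence all its terms vanish. *)
rewrite mulf_eq0 invr_eq0 (gt_eqF (card_gt0_of x0)) orbF => /eqP S0 x.
by apply: IH; apply: (psumr_eq0P _ S0) => // y _; apply: Ex_ge0.
Qed.

Lemma Pr_eq1 m E : Pr m E = 1 <-> always m E.
Proof.
rewrite Pr_Ex; split=> [H|H].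
  have /(@Ex_eq0 _ _) : Ex m (fun a => 1 - (E a)%:R) = 0.
    by rewrite Ex_sub Ex_cst H subrr.
  move=> /(_ _)/always_impl; apply=> a; first by case: (E a); rewrite ?subrr ?subr0.
  by case: (E a) => //=; rewrite subr0 => /eqP; rewrite oner_eq0.
by rewrite -[RHS](Ex_cst m); apply: (eq_Ex_always H) => a ->.
Qed.

Definition deq (m m' : rand A) : Prop := forall E, Pr m E = Pr m' E.

End RandTheory.

(* An expectation is a finite combination of the probabilities of the level
   sets of the integrand. *)
Lemma deq_Ex A (m m' : rand A) (phi : A -> rat) :
  deq m m' -> Ex m phi = Ex m' phi.
Proof.
have values (n : rand A) : exists r : seq rat, always n (fun a => phi a \in r).
  elim: n => [a|T x0 k IH] /=; first by exists [:: phi a]; rewrite inE.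
  have [r Hr] := fin_all_exists IH.
  exists (flatten [seq r x | x <- enum T]) => x; apply: always_impl (Hr x) => a ra.
  by apply/flattenP; exists (r x) => //; apply: map_f; rewrite mem_enum.
have Ex_level (n : rand A) (r : seq rat) : uniq r -> always n (fun a => phi a \in r) ->
    Ex n phi = \sum_(v <- r) Pr n (fun a => phi a == v) * v.
  move=> ru rP; under eq_bigr do rewrite Pr_Ex -Ex_mulr.
  rewrite -Ex_sum; apply: (eq_Ex_always rP) => a ar.
  rewrite (bigD1_seq (phi a)) //= eqxx mul1r big1 ?addr0 // => v nv.
  by rewrite eq_sym (negPf nv) mul0r.
move=> mm'; have [r Hr] := values m; have [r' Hr'] := values m'.
rewrite (Ex_level m (undup (r ++ r'))) ?undup_uniq //; last first.
  by apply: always_impl Hr => a; rewrite mem_undup mem_cat => ->.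
rewrite (Ex_level m' (undup (r ++ r'))) ?undup_uniq //; last first.
  by apply: always_impl Hr' => a; rewrite mem_undup mem_cat => ->; rewrite orbT.
by apply: eq_bigr => v _; rewrite mm'.
Qed.

Lemma deq_bind A B (m m' : rand A) (f f' : A -> rand B) :
  deq m m' -> (forall a, deq (f a) (f' a)) -> deq (bind m f) (bind m' f').
Proof.
by move=> mm' ff' E; rewrite !Pr_bind (deq_Ex _ mm'); apply: eq_Ex => a; apply: ff'.
Qed.

Lemma deq_map A B (p : A -> B) (m : rand A) (m' : rand B) :
  (forall E, Pr m (E \o p) = Pr m' E) -> deq (let* a := m in Ret (p a)) m'.
Proof. by move=> H E; rewrite Pr_bind -H Pr_Ex. Qed.

Lemma deq_bind_cst A B (m : rand A) (f : A -> rand B) n :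
  (forall a, deq (f a) n) -> deq (bind m f) n.
Proof. by move=> fn E; rewrite Pr_bind (eq_Ex _ (fun a => fn a E)) Ex_cst. Qed.

Lemma deq_ret A (m : rand A) : deq (let* a := m in Ret a) m.
Proof. by apply: deq_map. Qed.

(** Fubini for finite sums. The two trees draw in different orders, so only their distributions
    agree. *)
Lemma deq_swap A B C (m : rand A) (n : rand B) (f : A -> B -> rand C) :
  deq (let* a := m in let* b := n in f a b) (let* b := n in let* a := m in f a b).
Proof.
move=> E; elim: m => [//|T x0 k IH] /=.
rewrite (eq_bigr _ (fun x _ => IH x)).
under eq_bigr do rewrite Pr_bind.
by rewrite -Ex_sum -Ex_mulr Pr_bind; apply: eq_Ex.
Qed.

(** * Running and composing programs *)

Section Machine.

Local Open Scope nat_scope.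

Lemma always_bind A B (m : rand A) (f : A -> rand B) (P : B -> Prop) :
  always (bind m f) P <-> always m (fun a => always (f a) P).
Proof. by elim: m => [//|T x0 k IH] /=; split=> H x; apply/IH. Qed.

Definition halts T k s := always (run T k s) isSome.

Lemma run_nil T s : run T [::] s = Ret (Some s).
Proof. by case: T. Qed.

Lemma run_fuel T T' k s : halts T k s -> T <= T' -> run T' k s = run T k s.
Proof.
rewrite /halts; elim: T T' k s => [|T IH] T' [|c k] s; rewrite ?run_nil //.
case: T' => [//|T'] H leT.
case: c H => [b x|x|x y|x|c1 c2|x c1 c2|x c1] /= H; try exact: IH.
by congr Draw; apply: functional_extensionality => b; apply: IH => //; apply: H.
Qed.

Lemma run_cat T1 T2 k1 k2 s :
  always (run T1 k1 s) (fun o => if o is Some s' then halts T2 k2 s' else False) ->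
  run (T1 + T2) (k1 ++ k2) s =
  let* o := run T1 k1 s in if o is Some s' then run T2 k2 s' else Ret None.
Proof.
elim: T1 k1 s => [|T1 IH] [|c k1] s /=; rewrite ?run_nil //=.
  by move=> H; apply: (@run_fuel _ (T1 + T2).+1) => //; lia.
case: c => [b x|x|x y|x|c1 c2|x c1 c2|x c1] H; try exact: (IH (_ :: _)); try exact: IH.
- by congr Draw; apply: functional_extensionality => b; apply: IH; apply: H.
- exact: (IH [:: c1, c2 & k1]).
- by move: H; case: nilp => H; [apply: IH | apply: (IH [:: c1, While x c1 & k1])].
Qed.

(* An equality of trees, not only of distributions: the unused part of the
   budget [T] leaves no trace. *)
Definition yields T k s (m : rand store) :=
  run T k s = let* s' := m in Ret (Some s').

Lemma yields_halts T k s m : yields T k s m -> halts T k s.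
Proof. by rewrite /halts => ->; elim: m => /=. Qed.

Lemma halts_yields T k s :
  halts T k s -> yields T k s (let* o := run T k s in Ret (odflt s o)).
Proof.
move=> H; rewrite /yields bindA /=; move: H; rewrite /halts.
elim: (run T k s) => [[s'|]|U x0 f IH] //= H.
by congr Draw; apply: functional_extensionality => x; apply: IH.
Qed.

Lemma yields_fuel T T' k s m : T <= T' -> yields T k s m -> yields T' k s m.
Proof. by move=> le Y; rewrite /yields (run_fuel (yields_halts Y) le). Qed.

Lemma yields_cat T1 T2 k1 k2 s m1 m2 :
  yields T1 k1 s m1 -> always m1 (fun s' => yields T2 k2 s' (m2 s')) ->
  yields (T1 + T2) (k1 ++ k2) s (bind m1 m2).
Proof.
move=> Y1 Y2; rewrite /yields run_cat Y1 ?always_bind /=; last first.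
  by apply: always_impl Y2 => s' /yields_halts.
by rewrite !bindA; apply: (eq_bind_always Y2).
Qed.

Lemma yields_seq T1 T2 c1 c2 s m1 m2 :
  yields T1 [:: c1] s m1 -> always m1 (fun s' => yields T2 [:: c2] s' (m2 s')) ->
  yields (T1 + T2).+1 [:: Seq c1 c2] s (bind m1 m2).
Proof. exact: yields_cat. Qed.

(** The empty list becomes [Copy 0 0], a one-step no-op. *)
Fixpoint moves (l : seq (nat * nat)) : prog :=
  if l is (x, y) :: l then Seq (Copy x y) (moves l) else Copy 0 0.

Definition moved (l : seq (nat * nat)) (s : store) : store := fun x =>
  if x \in unzip1 l then s (nth 0 (unzip2 l) (index x (unzip1 l))) else s x.

(** No source is a target, so no copy destroys a register still to be read, and the successive
    copies amount to the simultaneous assignment [moved]. *)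
Lemma yields_moves l s : uniq (unzip1 l) ->
  {in unzip2 l, forall y, y \notin unzip1 l} ->
  yields (2 * size l).+1 [:: moves l] s (Ret (moved l s)).
Proof.
elim: l s => [|[x y] l IH] s /= => [_ _|/andP[xl ul] disj].
  rewrite /yields /=; congr (Ret (Some _)).
  by apply: functional_extensionality => z; rewrite /upd /moved /=; case: eqP => // ->.
have {}IH := IH (upd s x (s y)) ul.
have -> : Ret (moved ((x, y) :: l) s)
    = let* s' := Ret (upd s x (s y)) in Ret (moved l s').
  congr Ret; apply: functional_extensionality => z.
  have [->|nzx] := eqVneq z x.
    by rewrite /moved /= inE eqxx /= (negPf xl) /upd eqxx.
  rewrite /moved /= inE (negPf nzx) eq_sym (negPf nzx) /=.
  case: ifP => zl; last by rewrite /upd (negPf nzx).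
  set w := nth _ _ _; have wl : w \in unzip2 l.
    by apply: mem_nth; rewrite size_map -(size_map fst l) index_mem.
  have := disj w; rewrite inE wl orbT => /(_ isT).
  by rewrite inE negb_or /upd => /andP[/negPf -> _].
apply: (@yields_fuel (1 + (2 * size l).+1).+1); first by rewrite mulnS add1n add2n.
apply: yields_seq => /=; first by rewrite /yields.
apply: IH => w wl; have := disj w; rewrite inE wl orbT => /(_ isT).
by rewrite inE negb_or => /andP[].
Qed.

Section Rename.
Variables (f g : nat -> nat).
Hypothesis fK : cancel f g.

Fixpoint rename (c : prog) : prog :=
  match c with
  | Push b x => Push b (f x)
  | Pop x => Pop (f x)
  | Copy x y => Copy (f x) (f y)
  | Flip x => Flip (f x)
  | Seq c1 c2 => Seq (rename c1) (rename c2)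
  | If x c1 c2 => If (f x) (rename c1) (rename c2)
  | While x c1 => While (f x) (rename c1)
  end.

(** The test [f (g y) == y] recognizes the range of [f]: the bank carries [s'] and the remaining
    registers keep [s]. *)
Definition overlay (s s' : store) : store := fun y =>
  if f (g y) == y then s' (g y) else s y.

Lemma overlay_f s s' x : overlay s s' (f x) = s' x.
Proof. by rewrite /overlay fK eqxx. Qed.

Lemma upd_overlay s s' x v : upd (overlay s s') (f x) v = overlay s (upd s' x v).
Proof.
apply: functional_extensionality => y; rewrite /upd /overlay.
have [->|ny] := eqVneq y (f x); first by rewrite fK !eqxx.
case: eqP => // e; case: (g y =P x) => // gx; case/eqP: ny.
by rewrite -e gx.
Qed.

(** A frame property: the renamed commands read and write only the range of [f], where they act as
    the originals do on [s']. *)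
Lemma run_rename T k s s' :
  run T (map rename k) (overlay s s') =
  let* o := run T k s' in Ret (omap (overlay s) o).
Proof.
elim: T k s' => [|T IH] [|c k] s' //=.
case: c => [b x|x|x y|x|c1 c2|x c1 c2|x c1] /=; rewrite ?overlay_f ?upd_overlay ?IH //.
- by congr Draw; apply: functional_extensionality => b; rewrite upd_overlay IH.
- by rewrite -(IH [:: c1, c2 & k]).
- by rewrite -(IH (_ :: k)); case: head.
- by case: nilp; rewrite -IH.
Qed.

Lemma overlay_id s : overlay s (fun x => s (f x)) = s.
Proof. by apply: functional_extensionality => y; rewrite /overlay; case: eqP => // ->. Qed.

Lemma yields_rename T c s m : yields T [:: c] (fun x => s (f x)) m ->
  yields T [:: rename c] s (let* s' := m in Ret (overlay s s')).
Proof.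
move=> Y; rewrite /yields -{1}(overlay_id s) (run_rename T [:: c]) Y !bindA.
by [].
Qed.

End Rename.

(** One step lengthens the longest register by at most one bit. This bounds the strings that a first
    program hands to a second one. *)
Lemma size_run T k s M : (forall x, size (s x) <= M) ->
  always (run T k s) (fun o => if o is Some s' then forall x, size (s' x) <= M + T else True).
Proof.
elim: T k s M => [|T IH] [|c k] s M H /=; rewrite ?addn0 //.
  by move=> x; apply: leq_trans (H x) (leq_addr _ _).
have up x v : size v <= M.+1 -> forall y, size (upd s x v y) <= M.+1.
  by move=> Hv y; rewrite /upd; case: eqP => // _; apply: leqW.
rewrite addnS -addSn.
have le x : size (s x) <= M.+1 by apply: leqW.
case: c => [b x|x|x y|x|c1 c2|x c1 c2|x c1]; try by move=> *; apply: IH => //; apply: up;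
  rewrite ?ltnS // ?size_behead //; have := H x; lia.
Qed.

End Machine.

(** * Polynomial bounds *)

Section Polynomial.

Local Open Scope nat_scope.

(** The base [n.+1] is positive, so a larger exponent never lowers the bound; sums can then be
    bounded by adding exponents. *)
Definition polynomial (b : nat -> nat) : Prop :=
  exists c e, forall n, b n <= c * n.+1 ^ e.

Lemma polynomial_cst a : polynomial (fun=> a).
Proof. by exists a, 0 => n; rewrite expn0 muln1. Qed.

Lemma polynomial_id : polynomial id.
Proof. by exists 1, 1 => n; rewrite mul1n expn1. Qed.

Lemma polynomialD b b' : polynomial b -> polynomial b' ->
  polynomial (fun n => b n + b' n).
Proof.
move=> [c [e H]] [c' [e' H']]; exists (c + c'), (e + e') => n.
rewrite mulnDl leq_add //.
  by apply: leq_trans (H n) _; rewrite leq_mul2l leq_pexp2l ?leq_addr ?orbT.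
by apply: leq_trans (H' n) _; rewrite leq_mul2l leq_pexp2l ?leq_addl ?orbT.
Qed.

Lemma polynomialM b b' : polynomial b -> polynomial b' ->
  polynomial (fun n => b n * b' n).
Proof.
move=> [c [e H]] [c' [e' H']]; exists (c * c'), (e + e') => n.
by rewrite expnD mulnACA leq_mul.
Qed.

Lemma polynomialX b k : polynomial b -> polynomial (fun n => b n ^ k).
Proof.
move=> pb; elim: k => [|k IH]; first exact: polynomial_cst.
have [c [e H]] := polynomialM pb IH.
by exists c, e => n; rewrite expnS.
Qed.

Lemma polynomial_bound b : polynomial b -> exists e, forall n, b n <= n ^ e + e.
Proof.
(* As additive constant the witness covers size 0 through [c] and size 1 through [c * 2 ^ e]. From
   size 2 on, its part [2 * e + c] suffices as exponent, because [n + 1 <= n ^ 2] and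
   [c <= 2 ^ c <= n ^ c]. *)
move=> [c [e H]]; exists (c * 2 ^ e + 2 * e + c) => -[|[|n]].
- apply: leq_trans (H 0) _; rewrite exp1n muln1.
  by rewrite addnA leq_addl.
- by apply: leq_trans (H 1) _; rewrite -addnA addnCA leq_addr.
- apply: leq_trans (H n.+2) _; apply: leq_trans (leq_addr _ _).
  apply: (@leq_trans (n.+2 ^ (2 * e + c))); last by rewrite leq_exp2l // -addnA leq_addl.
  rewrite expnD mulnC expnM leq_mul //.
    by case: (e) => // e'; rewrite leq_exp2r //; nia.
  apply: leq_trans (ltnW (ltn_expl c (ltnSn 1))) _.
  by case: (c) => // c'; rewrite leq_exp2r.
Qed.

End Polynomial.

(** * Polynomial-time programs with flexible budgets, and block copies *)

Section Compilation.

Local Open Scope nat_scope.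

Definition init (input : seq bits) : store := nth [::] input.

Definition outcome T c s : rand store := let* o := run T [:: c] s in Ret (odflt s o).

Definition input_size lam (l : seq bits) := sumn (map size (nseq lam true :: l)).

(** Every sufficient budget [T] is allowed, because a program started on sampled strings has only an
    upper bound on its input size. The default in [outcome] is then never reached. *)
Lemma ppt_outcome X Y (enc : X -> seq bits) (out : store -> Y) f :
  ppt enc out f -> exists (c : prog) (e : nat), forall lam x T,
    input_size lam (enc x) ^ e + e <= T ->
    let s := init (nseq lam true :: enc x) in
    yields T [:: c] s (outcome T c s) /\
    deq (let* s' := outcome T c s in Ret (out s')) (f lam x).
Proof.
move=> [c [e H]]; exists c, e => lam x T leT s.
have [/Pr_eq1 halt distr] := H lam x.
have Y1 := halts_yields halt.
have eqr := run_fuel halt leT.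
have YT : yields T [:: c] s (outcome T c s).
  by apply: halts_yields; rewrite /halts eqr.
split=> //; apply: deq_map => E; rewrite -distr.
by rewrite -eqr YT [RHS]Pr_bind Pr_Ex.
Qed.

Lemma ppt_intro X Y (enc : X -> seq bits) (out : store -> Y) f c b :
  polynomial b ->
  (forall lam x, exists2 m,
    yields (b (input_size lam (enc x))) [:: c] (init (nseq lam true :: enc x)) m &
    deq (let* s := m in Ret (out s)) (f lam x)) ->
  ppt enc out f.
Proof.
move=> /polynomial_bound[e be] H; exists c, e => lam x input len final.
have [m Ym dm] := H lam x.
have {}Ym := yields_fuel (be _) Ym.
split; first by apply/Pr_eq1; apply: yields_halts Ym.
by move=> E; rewrite -dm /final Ym !Pr_bind.
Qed.

Lemma deq_ppt X Y (enc : X -> seq bits) (out : store -> Y) f g :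
  (forall lam x, deq (f lam x) (g lam x)) -> ppt enc out f -> ppt enc out g.
Proof.
move=> fg [c [e H]]; exists c, e => lam x; have [h d] := H lam x.
by split=> // E; rewrite -fg.
Qed.

Definition copy_all (f : nat -> nat) (ys : seq nat) : prog :=
  moves (zip (map f (iota 0 (size ys))) ys).

Definition copied (f : nat -> nat) (ys : seq nat) : store -> store :=
  moved (zip (map f (iota 0 (size ys))) ys).

Section CopyAll.
Variables (f : nat -> nat) (ys : seq nat).
Hypothesis f_inj : injective f.

Let sz : size (map f (iota 0 (size ys))) = size ys.
Proof. by rewrite size_map size_iota. Qed.

Lemma copied_f s k :
  copied f ys s (f k) = if k < size ys then s (nth 0 ys k) else s (f k).
Proof.
rewrite /copied /moved unzip1_zip ?sz // unzip2_zip ?sz // mem_map //.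
rewrite mem_iota add0n leq0n /=; case: ifP => // lk; congr (s (nth _ _ _)).
rewrite index_map //; have := @index_uniq _ 0 k (iota 0 (size ys)).
by rewrite nth_iota // add0n size_iota iota_uniq; apply.
Qed.

Lemma copied_out s y : (forall k, f k != y) -> copied f ys s y = s y.
Proof.
move=> fy; rewrite /copied /moved unzip1_zip ?sz //; case: ifP => // /mapP[k _ yk].
by have := fy k; rewrite yk eqxx.
Qed.

Lemma yields_copy_all s : (forall k, k < size ys -> f k \notin ys) ->
  yields (2 * size ys).+1 [:: copy_all f ys] s (Ret (copied f ys s)).
Proof.
move=> fys; rewrite -{1}(minnn (size ys)) -{1}sz -size_zip.
apply: yields_moves; rewrite ?unzip1_zip ?unzip2_zip ?sz //.
  by rewrite map_inj_uniq ?iota_uniq.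
move=> y yys; apply/mapP => -[k]; rewrite mem_iota add0n => /= /fys + yk.
by rewrite -yk yys.
Qed.

End CopyAll.

End Compilation.

Lemma deq_bind_always A B (m : rand A) (P : A -> Prop) (f f' : A -> rand B) :
  always m P -> (forall a, P a -> deq (f a) (f' a)) -> deq (bind m f) (bind m f').
Proof. by move=> mP ff' E; rewrite !Pr_bind; apply: (eq_Ex_always mP) => a /ff'. Qed.

(** * Composition of polynomial-time computations *)

Section Composition.

Local Open Scope nat_scope.

Definition regs n (s : store) : n.-tuple bits := [tuple s (nat_of_ord i) | i < n].

Definition sampler n (f : nat -> rand (n.-tuple bits)) :=
  ppt (fun _ : unit => [::]) (@regs n) (fun lam _ => f lam).

Lemma nth_regs n s j : j < n -> nth [::] (regs n s) j = s j.
Proof. by move=> jn; rewrite -[j]/(nat_of_ord (Ordinal jn)) -tnth_nth tnth_mktuple. Qed.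

Lemma overlay_out f g s s' y : (forall x, f x != y) -> overlay f g s s' y = s y.
Proof. by move=> fy; rewrite /overlay (negPf (fy _)). Qed.

(* [ins] routes to the inputs of the second program: [j < n1] is the [j]-th
   sampled string and [n1 + j] the [j]-th input. [outs] does so for the output,
   except that [n1 + j] is the final contents of register [j] of the second
   program. *)
Lemma ppt_compose n n1 (X X2 Y Y2 : Type) (enc : X -> seq bits)
    (enc2 : X2 -> seq bits) (out : store -> Y) (out2 : store -> Y2)
    (f1 : nat -> rand (n1.-tuple bits)) (f2 : nat -> X2 -> rand Y2)
    (h : n1.-tuple bits -> X -> X2) (p : n1.-tuple bits -> Y2 -> Y)
    (ins outs : seq nat) :
  (forall x, size (enc x) = n) -> all (fun j => j < n1 + n) ins ->
  (forall (q : n1.-tuple bits) x, enc2 (h q x) = [seq nth [::] (q ++ enc x) j | j <- ins]) ->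
  (forall (q : n1.-tuple bits) (s s2 : store),
    (forall k, k < size outs ->
       s k = let j := nth 0 outs k in
             if j < n1 then nth [::] q j else s2 (j - n1)) ->
    out s = p q (out2 s2)) ->
  sampler f1 -> ppt enc2 out2 f2 ->
  ppt enc out (fun lam x => let* q := f1 lam in let* y := f2 lam (h q x) in Ret (p q y)).
Proof.
move=> size_enc ins_lt encE outE /ppt_outcome[cA [eA HA]] /ppt_outcome[cB [eB HB]].
(* Bank A is made of the even, and bank B of the odd registers after those
   holding the input or the output. *)
pose o := (n + size outs).+1.
pose fA x := o + x.*2; pose fB x := o + x.*2.+1; pose g y := (y - o)./2.
have fAK : cancel fA g by move=> x; rewrite /fA /g addKn doubleK.
have fBK : cancel fB g by move=> x; rewrite /fB /g addKn /= uphalf_double.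
have fA_inj := can_inj fAK; have fB_inj := can_inj fBK.
have fAB x y : fA x != fB y.
  by apply/eqP => /addnI /(congr1 odd) /=; rewrite !odd_double.
have fBA x y : fB x != fA y by rewrite eq_sym.
have fA_low y x : y < o -> fA x != y by move=> ?; rewrite /fA; apply/eqP; lia.
have fB_low y x : y < o -> fB x != y by move=> ?; rewrite /fB; apply/eqP; lia.
(* Inputs are shifted by one because register 0 holds the unary security parameter. Both banks need
   that parameter too, hence the initial [Copy (fA 0) 0] and the leading 0 of [l1]. *)
pose src j := if j < n1 then fA j else (j - n1).+1.
pose l1 := 0 :: map src ins.
pose src2 j := if j < n1 then fA j else fB (j - n1).
pose l2 := map src2 outs.
pose c := Seq (Copy (fA 0) 0) (Seq (rename fA cA) (Seq (copy_all fB l1)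
            (Seq (rename fB cB) (copy_all id l2)))).
pose TA len := len ^ eA + eA.
(* The second program receives the security parameter and [size ins] strings, each of length at most
   [len + TA len] by [size_run]. *)
pose L len := (size ins).+1 * (len + TA len).
pose TB len := L len ^ eB + eB.
pose K := (2 * size l1).+1 + (2 * size l2).+1 + 5.
apply: (@ppt_intro _ _ _ _ _ c (fun len => TA len + TB len + K)).
  have pTA : polynomial TA.
    apply: polynomialD (polynomial_cst _); apply: polynomialX; exact: polynomial_id.
  apply: polynomialD (polynomial_cst _); apply: polynomialD => //.
  apply: polynomialD (polynomial_cst _); apply: polynomialX.
  by apply: polynomialM (polynomial_cst _) _; apply: polynomialD => //; apply: polynomial_id.
move=> lam x; set len := input_size _ _.
have len_enc : len = lam + sumn (map size (enc x)) by rewrite /len /input_size /= size_nseq.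
set s0 := init _.
have s0_high y : n < y -> s0 y = [::].
  by move=> ny; apply: nth_default; rewrite /= size_enc.
pose s1 := upd s0 (fA 0) (s0 0).
have s1A : (fun z => s1 (fA z)) = init [:: nseq lam true].
  apply: functional_extensionality => -[|z]; rewrite /s1 /upd ?eqxx //.
  rewrite (inj_eq fA_inj) /= s0_high; first by rewrite /init /= nth_nil.
  by rewrite /fA /o; lia.
have s1_out y : (forall z, fA z != y) -> s1 y = s0 y.
  by move=> fy; rewrite /s1 /upd eq_sym (negPf (fy 0)).
have le_lam : lam <= len by rewrite len_enc leq_addr.
have [] := HA lam tt (TA len).
  rewrite /input_size /= size_nseq addn0 /TA leq_add2r.
  by case: (eA) => // e; rewrite leq_exp2r.
set sA0 := init _ => YA dA.
have YA1 : yields (TA len) [:: rename fA cA] s1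
    (let* sA := outcome (TA len) cA sA0 in Ret (overlay fA g s1 sA)).
  by apply: yields_rename => //; rewrite s1A.
have size_enc_le j : size (nth [::] (enc x) j) <= len.
  rewrite len_enc; apply: leq_trans (leq_addl _ _).
  elim: (enc x) j => [|a l IH] [|j] //=; first exact: leq_addr.
  exact: leq_trans (IH j) (leq_addl _ _).
have small : always (outcome (TA len) cA sA0) (fun sA => forall z, size (sA z) <= len + TA len).
  have small0 z : size (sA0 z) <= len.
    by case: z => [|z]; rewrite /sA0 /init /= ?nth_nil // size_nseq.
  apply/always_bind; apply: always_impl (size_run (TA len) [:: cA] small0).
  by move=> [s' //|_ z] /=; apply: leq_trans (small0 z) (leq_addr _ _).
pose s2 sA := overlay fA g s1 sA.
pose s3 sA := copied fB l1 (s2 sA).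
pose sB0 q := init (nseq lam true :: enc2 (h q x)).
have s2A sA j : s2 sA (fA j) = sA j by rewrite /s2 overlay_f.
have s2_out sA y : (forall z, fA z != y) -> s2 sA y = s0 y.
  by move=> fy; rewrite /s2 overlay_out // s1_out.
(* Bank B is a genuine initial store: its registers beyond the copied strings have not been written
   and are still empty. *)
have s3B sA : (fun z => s3 sA (fB z)) = sB0 (regs n1 sA).
  apply: functional_extensionality => k; rewrite /s3 copied_f // /l1 /= size_map.
  case: k => [|k] /=; first by rewrite s2_out // => z; apply: fA_low.
  rewrite ltnS /sB0 /init /= encE; case: ifP => lk; last first.
    rewrite s2_out // s0_high; last by rewrite /fB /o; lia.
    by rewrite nth_default // size_map leqNgt lk.
  rewrite !(nth_map 0) // /src nth_cat size_tuple.
  have /(all_nthP 0)/(_ _ lk) := ins_lt => jn.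
  case: (ltnP _ n1) => jn1; first by rewrite s2A nth_regs.
  rewrite s2_out // => z; apply: fA_low; rewrite /o; lia.
have s3_out sA j : s3 sA (fA j) = sA j by rewrite /s3 copied_out.
pose s4 sA sB := overlay fB g (s3 sA) sB.
pose s5 sA sB := copied id l2 (s4 sA sB).
have out5 sA sB : out (s5 sA sB) = p (regs n1 sA) (out2 sB).
  apply: outE => k lk; rewrite /s5 (copied_f _ _ _ (f := id)) // size_map lk.
  rewrite (nth_map 0) // /src2 /=; case: ifP => jn1.
    by rewrite /s4 overlay_out // s3_out nth_regs.
  by rewrite /s4 overlay_f.
have fitB sA : (forall z, size (sA z) <= len + TA len) ->
    input_size lam (enc2 (h (regs n1 sA) x)) ^ eB + eB <= TB len.
  move=> sml; rewrite /TB leq_add2r.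
  suff: input_size lam (enc2 (h (regs n1 sA) x)) <= L len.
    by case: (eB) => // e; rewrite leq_exp2r.
  rewrite encE /input_size /= size_nseq /L mulSn leq_add //.
    exact: leq_trans le_lam (leq_addr _ _).
  elim: (ins) => //= j js IH; rewrite mulSn leq_add //.
  rewrite nth_cat size_tuple card_ord; case: ltnP => jn1; first by rewrite nth_regs //; apply: sml.
  exact: leq_trans (size_enc_le _) (leq_addr _ _).
(* [yields_seq] passes on the current store only, so the second run is expressed through that store
   and not through [sA]. *)
pose mB st := outcome (TB len) cB (fun z => st (fB z)).
pose m4 st := let* s := (let* sB := mB st in Ret (overlay fB g st sB)) in
  Ret (copied id l2 s).
pose m := let* s := Ret s1 in
  let* s := (let* sA := outcome (TA len) cA sA0 in Ret (s2 sA)) in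
  let* s := Ret (copied fB l1 s) in
  m4 s.
exists m.
  rewrite /m; apply: (@yields_fuel (1 + (TA len + ((2 * size l1).+1
      + (TB len + (2 * size l2).+1).+1).+1).+1).+1); first by rewrite /K; lia.
  apply: yields_seq => //.
  apply: yields_seq => //; apply/always_bind.
  apply: always_impl small => sA sml /=.
  apply: (@yields_seq _ _ _ _ _ (Ret (s3 sA)) m4) => [|/=].
    apply: (@yields_copy_all fB l1) => // k _.
    rewrite /l1 inE negb_or fB_low //=; apply/mapP => -[j jins].
    rewrite /src; case: ifP => jn1 /eqP; first by rewrite (negPf (fBA _ _)).
    have := allP ins_lt _ jins => jn; rewrite (negPf (fB_low _ _ _)) //.
    rewrite /o; move: jn jn1; lia.
  have YB := (HB lam (h (regs n1 sA) x) _ (fitB _ sml)).1.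
  apply: yields_seq.
    by apply: yields_rename => //; rewrite /mB
      [X in yields _ _ X](s3B sA) [X in outcome _ _ X](s3B sA).
  apply/always_bind; apply: always_impl (always_true _) => sB _ /=.
  apply: (@yields_copy_all id l2) => // k; rewrite size_map => lk.
  have {}lk : k < o by rewrite /o; lia.
    apply/mapP => -[j _]; rewrite /src2; case: ifP => _ /esym/eqP.
      by rewrite (negPf (fA_low _ _ _)).
    by rewrite (negPf (fB_low _ _ _)).
pose F q := let* sB := outcome (TB len) cB (sB0 q) in Ret (p q (out2 sB)).
pose F' q := let* y := f2 lam (h q x) in Ret (p q y).
have mE (oA : rand store) (oB : store -> rand store) :
    (let* s := (let* s := (let* sA := oA in Ret (s2 sA)) in
                let* s := (let* sB := oB (copied fB l1 s) in
                           Ret (overlay fB g (copied fB l1 s) sB)) in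
                Ret (copied id l2 s)) in Ret (out s))
    = let* sA := oA in let* sB := oB (s3 sA) in Ret (p (regs n1 sA) (out2 sB)).
  rewrite !bindA; apply: (eq_bind_always (always_true _)) => sA _ /=.
  rewrite !bindA; apply: (eq_bind_always (always_true _)) => sB _ /=.
  by rewrite -(out5 sA sB).
move=> E; transitivity (Pr (let* sA := outcome (TA len) cA sA0 in F (regs n1 sA)) E).
  rewrite [X in Pr X E](mE (outcome (TA len) cA sA0) mB); congr (Pr _ E).
  by apply: (eq_bind_always (always_true _)) => sA _; rewrite /mB (s3B sA).
(* The second program is replaced by [f2] first, while [small] still guarantees that its input fits
   the budget; the first program is replaced by [f1] afterwards. *)
transitivity (Pr (let* sA := outcome (TA len) cA sA0 in F' (regs n1 sA)) E).
  apply: (deq_bind_always small) => sA sml.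
  have [_ dB] := HB lam (h (regs n1 sA) x) _ (fitB _ sml).
  have -> : F (regs n1 sA) = let* y := (let* sB := outcome (TB len) cB (sB0 (regs n1 sA)) in
      Ret (out2 sB)) in Ret (p (regs n1 sA) y) by rewrite bindA.
  exact: deq_bind.
have -> : (let* sA := outcome (TA len) cA sA0 in F' (regs n1 sA))
    = let* q := (let* sA := outcome (TA len) cA sA0 in Ret (regs n1 sA)) in F' q.
  by rewrite bindA.
exact: (deq_bind dA).
Qed.

(** A fixed input is hardcoded by [i] pushes onto register 1, at the constant cost of [2 * i]
    steps. *)
Lemma ppt_push X Y (enc : X -> seq bits) (out : store -> Y) f (i : nat)
   (x : X) : enc x = [:: nseq i true] -> ppt enc out f ->
  ppt (fun _ : unit => [::]) out (fun lam _ => f lam x).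
Proof.
move=> encx /ppt_outcome[c [e H]].
(* Keeping the earlier contents [s 1] below the pushed bits makes the induction on [i] go
   through. *)
have push T c' s m : yields T [:: c'] (upd s 1 (nseq i true ++ s 1)) m ->
    yields (T + 2 * i) [:: iter i (Seq (Push true 1)) c'] s m.
  elim: i s {encx} => [|i IH] s yc.
    rewrite addn0; congr yields: yc; apply: functional_extensionality => z.
    by rewrite /upd; case: eqP => // ->.
  rewrite (_ : T + 2 * i.+1 = (1 + (T + 2 * i)).+1); last by lia.
  apply: (@yields_seq _ _ _ _ _ (Ret (upd s 1 (true :: s 1))) (fun=> m)) => //=.
  apply: IH; congr yields: yc; apply: functional_extensionality => z.
  rewrite /upd; case: eqP => //= _.
  by elim: (i) => //= j ->.
pose b len := (len + i) ^ e + e.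
apply: (@ppt_intro _ _ _ _ _ (iter i (Seq (Push true 1)) c) (fun len => b len + 2 * i)).
  apply: polynomialD (polynomial_cst _); apply: polynomialD (polynomial_cst _).
  by apply: polynomialX; apply: polynomialD (polynomial_cst _); apply: polynomial_id.
move=> lam _; have [] := H lam x (b (input_size lam [::])).
  by rewrite /b encx /input_size /= !size_nseq !addn0.
set s0 := init _; set m := outcome _ _ _ => yc d; exists m => //.
apply: push; congr yields: yc; apply: functional_extensionality => z.
by rewrite /upd /s0 encx /init; case: z => [|[|z]] //=; rewrite ?cats0 ?nth_nil.
Qed.

Lemma deq_out X Y Z (enc : X -> seq bits) (out : store -> Y) (pr : Y -> Z) f :
  ppt enc out f -> ppt enc (fun s => pr (out s)) (fun lam x => let* y := f lam x in Ret (pr y)).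
Proof.
move=> [c [e H]]; exists c, e => lam x; have [h d] := H lam x.
by split=> // E; have := d (E \o pr) => /= ->; rewrite Pr_bind Pr_Ex.
Qed.

End Composition.

(** * Bounds on expectations and negligible functions *)

Lemma Ex_le A (m : rand A) (phi psi : A -> rat) :
  (forall a, phi a <= psi a) -> Ex m phi <= Ex m psi.
Proof. by move=> H; rewrite -subr_ge0 -Ex_sub Ex_ge0 // => a; rewrite subr_ge0. Qed.

Lemma Ex_norm_le A (m : rand A) (phi : A -> rat) c :
  (forall a, `|phi a| <= c) -> `|Ex m phi| <= c.
Proof.
move=> H; rewrite ler_norml -[- c](Ex_cst m) -[X in _ && (_ <= X)](Ex_cst m).
by apply/andP; split; apply: Ex_le => a; have := H a; rewrite ler_norml => /andP[].
Qed.

Section Negligible.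

Lemma negligible0 : negligible (fun=> 0).
Proof.
move=> c; exists 1%N => lam lam0.
by rewrite normr0 invr_gt0 exprn_gt0 // ltr0n.
Qed.

Lemma negligibleD mu nu : negligible mu -> negligible nu ->
  negligible (fun lam => mu lam + nu lam).
Proof.
(* The extra power of [lam] absorbs the factor 2 as soon as [lam] is at least 2. *)
move=> Hmu Hnu c; have [N HN] := Hmu c.+1; have [M HM] := Hnu c.+1.
exists (maxn 2 (maxn N M)) => lam; rewrite !geq_max => /and3P[lam2 lamN lamM].
have lam0 : 0 < lam%:R :> rat by rewrite ltr0n ltnW.
apply: le_lt_trans (ler_normD _ _) _.
apply: lt_le_trans (ltrD (HN _ lamN) (HM _ lamM)) _.
rewrite -mulr2n -[_ *+ 2]mulr_natl exprS invfM mulrA ler_piMl ?invr_ge0 ?exprn_ge0 ?ler0n //.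
by rewrite ler_pdivrMr // mul1r ler_nat.
Qed.

Lemma negligible_sum (I : Type) (r : seq I) (mu : I -> nat -> rat) :
  (forall i, negligible (mu i)) -> negligible (fun lam => \sum_(i <- r) mu i lam).
Proof.
move=> Hmu; elim: r => [|i r IH] c.
  by have [N HN] := negligible0 c; exists N => lam /HN; rewrite big_nil.
have [N HN] := negligibleD (Hmu i) IH c.
by exists N => lam /HN; rewrite big_cons.
Qed.

(** The common bound is the sum of the individual ones, which are nonnegative because they dominate
    [F]. *)
Lemma negligible_uniform (I : finType) (F : I -> nat -> rat) :
  (forall i lam, 0 <= F i lam) ->
  (forall i, exists2 mu, negligible mu & forall lam, F i lam <= mu lam) ->
  exists2 mu, negligible mu & forall lam i, F i lam <= mu lam.
Proof.
move=> F0 /fin_all_exists2[mu Hmu leF].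
exists (fun lam => \sum_i mu i lam); first exact: negligible_sum.
move=> lam i; rewrite (bigD1 i) //= -[F i lam]addr0 lerD ?leF //.
by apply: sumr_ge0 => j _; apply: le_trans (F0 j lam) (leF j lam).
Qed.

End Negligible.

Lemma traverse_map A B C (f : A -> rand B) (g : B -> C) n (t : n.-tuple A) :
  (let* ys := traverse f t in Ret (map_tuple g ys))
  = traverse (fun x => let* y := f x in Ret (g y)) t.
Proof.
elim: n t => [|n IH] t /=; first by congr Ret; apply: val_inj.
rewrite !bindA; apply: (eq_bind_always (always_true _)) => y _ /=.
rewrite -IH !bindA; apply: (eq_bind_always (always_true _)) => ys _ /=.
by congr Ret; apply: val_inj.
Qed.

Lemma ppt_distinguisher_sample n n1 m (f : nat -> rand (n1.-tuple bits))
    (D : nat -> m.-tuple bits -> rand bool)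
    (h : n1.-tuple bits -> n.-tuple bits -> m.-tuple bits) (ins : seq nat) :
  all (fun j => j < n1 + n)%N ins ->
  (forall q x, tval (h q x) = [seq nth [::] (q ++ x) j | j <- ins]) ->
  sampler f -> ppt_distinguisher D ->
  ppt_distinguisher (fun lam x => let* q := f lam in D lam (h q x)).
Proof.
move=> ins_lt hE sf sD.
apply: (@deq_ppt _ _ _ _ (fun lam x =>
    let* q := f lam in let* y := D lam (h q x) in Ret y)).
  by move=> lam x; apply: deq_bind => // q; apply: deq_ret.
(* The output list [[:: n1]] designates register 0 of the second program, where [D] leaves its
   verdict. *)
apply: (@ppt_compose n n1 _ _ _ _ _ (@tval m bits) _ out_bit f D h (fun _ y => y)
  ins [:: n1]) => //; first exact: size_tuple.
by move=> q s s2 /(_ 0%N isT) /=; rewrite ltnn subnn /out_bit => ->.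
Qed.

(** * Hybrid argument *)

Section Queries.
Variables (n : nat) (Rec : eqType) (P : pir n Rec).
Hypothesis P_ppt : query_ppt P.

Lemma sampler_query (i : 'I_n) :
  sampler (fun lam => let* q := query_message P lam i in Ret [tuple q]).
Proof.
have := deq_out (fun y => [tuple y.1]) (ppt_push (x := i) (erefl _) P_ppt).
rewrite (_ : (fun s => _) = @regs 1); last first.
  apply: functional_extensionality => s; apply: eq_from_tnth => j.
  by rewrite tnth_mktuple (ord1 j).
apply: deq_ppt => lam _; rewrite /query_message bindA; exact: deq_bind.
Qed.

Lemma sampler_traverse k (r : k.-tuple 'I_n) :
  sampler (fun lam => traverse (query_message P lam) r).
Proof.
elim: k r => [|k IH] r.
  apply: (@ppt_intro _ _ _ _ _ (Copy 0 0) (fun=> 1%N)); first exact: polynomial_cst.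
  move=> lam x; set s := init _; exists (Ret (upd s 0 (s 0%N))) => //= E /=.
  by rewrite (tuple0 (regs _ _)).
apply: (@deq_ppt _ _ _ _ (fun lam _ =>
    let* q := (let* q := query_message P lam (thead r) in Ret [tuple q]) in
    let* ys := traverse (query_message P lam) (behead_tuple r) in
    Ret (cons_tuple (thead q) ys))).
  by move=> lam _; rewrite bindA.
(* In the output list, 0 is the query sampled first and [1 + j] is register [j] of the program for
   the remaining rows. *)
apply: (@ppt_compose 0 1 _ unit _ _ _ (fun=> [::]) _ (@regs k) _
  (fun lam _ => traverse (query_message P lam) (behead_tuple r)) (fun _ _ => tt)
  (fun q ys => cons_tuple (thead q) ys) [::] (iota 0 k.+1)) => //.
- move=> q s s2 H; apply: eq_from_tnth => j.
  rewrite !(tnth_nth [::]) nth_regs // H ?size_iota //.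
  rewrite nth_iota // add0n; case: (ltnP j 1) => [|j0].
    by rewrite ltnS leqn0 => /eqP ->; rewrite /thead /= (tnth_nth [::]).
  case: j j0 => -[|j] //= jk _; rewrite subSS subn0.
  by rewrite -[RHS]/(nth [::] (regs k s2) j) nth_regs.
- exact: sampler_query.
- exact: IH.
Qed.

Hypothesis P_private : pir_private P.

(** The hybrid with the head of [r'] and the tail of [r] separates a change of the first row,
    handled by [pir_private], from a change of the tail, handled by induction for a modified
    distinguisher. *)
Lemma traverse_indistinguishable k (D : nat -> k.-tuple bits -> rand bool)
    (r r' : k.-tuple 'I_n) :
  ppt_distinguisher D ->
  exists2 mu, negligible mu & forall lam,
    `|Pr (let* v := traverse (query_message P lam) r in D lam v) id
      - Pr (let* v := traverse (query_message P lam) r' in D lam v) id| <= mu lam.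
Proof.
elim: k D r r' => [|k IH] D r r' pD.
  by exists (fun=> 0); [exact: negligible0 | move=> lam /=; rewrite subrr normr0].
have pD1 : @ppt_distinguisher 1 (fun lam t =>
    let* v := traverse (query_message P lam) (behead_tuple r) in
    D lam (cons_tuple (thead t) v)).
  (* The [k] sampled strings are numbered first, so the challenge query has number [k] and is routed
     to the front. *)
  apply: (@ppt_distinguisher_sample 1 k _ _ D (fun v t => cons_tuple (thead t) v)
    (k :: iota 0 k)) => //; last exact: sampler_traverse.
    rewrite /= addn1 ltnSn; apply/allP => j; rewrite mem_iota add0n => /= jk.
    exact: leqW.
  move=> v t /=; rewrite nth_cat size_tuple ltnn subnn; congr (_ :: _).
    by rewrite /thead (tnth_nth [::]).
  by rewrite map_nth_iota0 ?take_size_cat ?size_cat ?size_tuple ?leq_addr.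
have pD2 : @ppt_distinguisher k (fun lam v =>
    let* t := (let* q := query_message P lam (thead r') in Ret [tuple q]) in
    D lam (cons_tuple (thead t) v)).
  apply: (@ppt_distinguisher_sample k 1 _ _ D (fun t v => cons_tuple (thead t) v)
    (iota 0 k.+1)) => //; last exact: sampler_query.
    by apply/allP => j; rewrite mem_iota.
  move=> t v; case/tupleP: t => q t; rewrite (tuple0 t) theadE.
  by rewrite map_nth_iota0 ?take_oversize //= size_tuple.
have [mu1 neg1 H1] := P_private pD1.
have [mu2 neg2 H2] := IH _ (behead_tuple r) (behead_tuple r') pD2.
exists (fun lam => mu1 lam + mu2 lam); first exact: negligibleD.
move=> lam.
have travE t : (let* v := traverse (query_message P lam) t in D lam v)
    = let* q := query_message P lam (thead t) in
      let* v := traverse (query_message P lam) (behead_tuple t) in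
      D lam (cons_tuple q v).
  rewrite /= bindA; apply: (eq_bind_always (always_true _)) => q _.
  by rewrite bindA.
rewrite !travE; set mid := Pr (let* q := query_message P lam (thead r') in
  let* v := traverse (query_message P lam) (behead_tuple r) in D lam (cons_tuple q v)) id.
rewrite -(subrKA mid); apply: le_trans (ler_normD _ _) _; apply: lerD.
  exact: (H1 lam (thead r) (thead r')).
have := H2 lam.
(* The second distinguisher samples the head after receiving the tail, whereas [traverse] draws the
   head first. *)
have swap (t : k.+1.-tuple 'I_n) :
    Pr (let* v := traverse (query_message P lam) (behead_tuple t) in
      let* t := (let* q := query_message P lam (thead r') in Ret [tuple q]) in
      D lam (cons_tuple (thead t) v)) id
    = Pr (let* q := query_message P lam (thead r') in
      let* v := traverse (query_message P lam) (behead_tuple t) in D lam (cons_tuple q v)) id.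
  rewrite [RHS]deq_swap; congr (Pr _ id).
  by apply: (eq_bind_always (always_true _)) => v _; rewrite bindA.
by rewrite !swap.
Qed.

End Queries.

(** * The view of the server *)

Section View.
Variables (R : realType) (pp : params R) (P : pir (rows pp) (row_record pp)).

(** Neither the batch nor the queries depend on the private state [st], so preprocessing is
    discarded like the answers and the decoding, by [deq_bind_cst]. *)
Lemma server_view_deq lam Q :
  deq (server_view P lam Q) (let* r := batch Q in traverse (query_message P lam) r).
Proof.
rewrite /server_view /execution bindA; apply: deq_bind_cst => st.
rewrite bindA; apply: deq_bind => // r E; rewrite bindA.
rewrite -[in RHS]/(fun i => let* q := pir_query P lam i in Ret q.1) -traverse_map.
apply: deq_bind E => // qs.
rewrite bindA; apply: deq_bind_cst => answers.
by rewrite bindA; apply: deq_bind_cst.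
Qed.

End View.

Theorem theorem1 (R : realType) (pp : params R) (P : pir (rows pp) (row_record pp)) :
  computationally_private P -> secure_semi_honest_server P.
Proof.
move=> [P_ppt _ P_private].
pose r0 : (batch_size pp).-tuple 'I_(rows pp) := [tuple Ordinal (rows_gt0 pp) | _ < _].
exists (fun lam => traverse (query_message P lam) r0); first exact: sampler_traverse.
move=> D pD.
have [] := @negligible_uniform _ (fun r lam =>
    `|Pr (let* v := traverse (query_message P lam) r in D lam v) id
      - Pr (let* v := traverse (query_message P lam) r0 in D lam v) id|).
- by move=> r lam; apply: normr_ge0.
- by move=> r; apply: traverse_indistinguishable.
move=> mu neg Hmu; exists mu => // lam Q.
have /(_ id) -> : deq (let* v := server_view P lam Q in D lam v)
    (let* v := (let* r := batch Q in traverse (query_message P lam) r) in D lam v).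
  by apply: deq_bind => //; apply: server_view_deq.
rewrite bindA Pr_bind.
(* The probability for the simulator is constant in the batch. Averaging it over [batch Q] turns the
   advantage into an expectation of differences, each at most [mu lam] in absolute value. *)
rewrite -(Ex_cst (batch Q) (Pr (bind (traverse _ r0) _) _)) -Ex_sub.
by apply: Ex_norm_le => r; apply: Hmu.
Qed.
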